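(* Let $G$ be a claw-free hamiltonian graph of order $n$ and maximum degree $\Delta$ with $\Delta\geq 24$. Then $$s(G)\geq \min\left\{ n,\left\lceil\tfrac{3}{2}\Delta\right\rceil\right\}-2.$$
   Context: All graphs are finite, simple and undirected. The cycle spectrum $S(G)$ of a graph $G$ is the set of lengths of cycles in $G$, and $s(G)=|S(G)|$ is the number of distinct cycle lengths of $G$. A graph of order $n$ is hamiltonian if it contains a cycle through all $n$ vertices. A graph is claw-free if it contains no induced subgraph isomorphic to the star $K_{1,3}$. *)

(* Defs.v *)
From mathcomp Require Import all_boot.

Set Implicit Arguments.
Unset Strict Implicit.
Unset Printing Implicit Defensive.

(* A finite simple graph on T is given by its adjacency relation e : rel T,
   assumed symmetric and irreflexive. *)

Section Graphs.

Variables (T : finType) (e : rel T).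

Definition degree (x : T) : nat := #|[set y | e x y]|.

Definition max_degree : nat := \max_(x : T) degree x.

(* ucycleb alone also accepts [::] and, when e x y, the closed walk x, y, x. *)
Definition graph_cycle (c : seq T) : bool := (2 < size c) && ucycleb e c.

(* The length of a cycle is its number of vertices, hence at most #|T|, so
   'I_(#|T|.+1) contains all the cycle lengths. *)
Definition cycle_spectrum : {set 'I_(#|T|.+1)} :=
  [set k : 'I_(#|T|.+1) | [exists c : k.-tuple T, graph_cycle c]].

Definition hamiltonian : Prop :=
  exists2 c : seq T, graph_cycle c & forall x : T, x \in c.

End Graphs.

Definition induced_subgraph (S T : finType) (h : rel S) (e : rel T) : Prop :=
  exists2 f : S -> T, injective f & forall x y, e (f x) (f y) = h x y.

(* K_{1,3} with center 0 and leaves 1, 2, 3. *)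
Definition K1_3 : rel 'I_4 := fun i j => (i == ord0) != (j == ord0).

Definition claw_free (T : finType) (e : rel T) : Prop :=
  ~ induced_subgraph K1_3 e.

(* Main.v *)
(** Let [u] have maximum degree [D].  By claw-freeness no three neighbours of
    [u] are independent.  Hence a cycle through [u] whose neighbours of [u] see
    all the others can be enlarged by any disjoint path with both ends in
    [N(u)] (an ear), in particular by the neighbours of [u] one at a time: it
    yields an interval of cycle lengths whose upper end is
    [r + D + 1], where [r] counts its vertices outside [N(u)] and [u].

    Claw-freeness also lets the Hamiltonian cycle skip each neighbour of [u]
    lying between two non-neighbours, so all the non-neighbours are covered by
    disjoint ears.  Adding these ears one by one gives a chain of intervals.
    If two consecutive intervals leave a gap, they are disjoint and long enough
    to contain [3D/2 - 2] lengths together; if no gap ever occurs, all lengths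
    from 3 to the order of the graph are present.

    If [N(u)] is connected, three vertices of it see all the others, and the
    chain starts with the lengths up to [D + 1].  Otherwise [N(u)] consists of
    two cliques; the chain starts with the lengths inside the larger clique and
    an ear joining the two cliques. *)

Require Import Defs.
From mathcomp Require Import all_boot zify.

Set Implicit Arguments.
Unset Strict Implicit.
Unset Printing Implicit Defensive.

(** * Ears at [u] and rings through [u] *)

Section Neighbourhood.

Variables (T : finType) (e : rel T) (u : T).
Hypotheses (e_sym : symmetric e) (e_irr : irreflexive e).
Hypothesis claw_edge : forall c x y z, e c x -> e c y -> e c z ->
  x != y -> x != z -> y != z -> [|| e x y, e x z | e y z].

(** The default [u] in [head] and [last] excludes the empty list, since [e u u] fails. A single
    neighbour of [u] is an ear. *)
Definition ear (b : seq T) : Prop :=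
  [/\ sorted e b, e u (head u b), e u (last u b), u \notin b &
      forall x, x \in b -> e u x -> x = head u b \/ x = last u b].

Definition link (b b' : seq T) : bool := e (last u b) (head u b').

(* The cycle is [u :: flatten bs]; [u] closes it since ears end in [N(u)]. *)
Definition ring (bs : seq (seq T)) : Prop :=
  [/\ bs != [::], forall b, b \in bs -> ear b, uniq (flatten bs) &
      sorted link bs].

Lemma ear_neq0 b : ear b -> b != [::].
Proof. by case: b => // -[_]; rewrite /= e_irr. Qed.

Lemma head_rev_last (b : seq T) : head u (rev b) = last u b.
Proof. by case/lastP: b => // b x; rewrite rev_rcons last_rcons. Qed.

Lemma last_rev_head (b : seq T) : last u (rev b) = head u b.
Proof. by rewrite -head_rev_last revK. Qed.

Lemma mem_head_ear b : ear b -> head u b \in b.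
Proof. by move/ear_neq0; case: b => // x b _; rewrite mem_head. Qed.

Lemma mem_last_ear b : ear b -> last u b \in b.
Proof. by move/ear_neq0; case: b => // x b _; exact: (mem_last x b). Qed.

Lemma ear_rev b : ear b -> ear (rev b).
Proof.
case=> sb hb lb ub nb; split.
- by rewrite rev_sorted (eq_sorted (e' := e)) // => x y; rewrite e_sym.
- by rewrite head_rev_last.
- by rewrite last_rev_head.
- by rewrite mem_rev.
- move=> x; rewrite mem_rev head_rev_last last_rev_head => xb ux.
  by case: (nb x xb ux); [right | left].
Qed.

Lemma ear1 v : e u v -> ear [:: v].
Proof.
move=> uv; split=> //=; last by move=> x; rewrite inE => /eqP; left.
by rewrite inE; apply: contraTneq uv => ->; rewrite e_irr.
Qed.

Lemma ring_rev bs : ring bs -> ring (rev (map rev bs)).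
Proof.
case=> bs0 eb ub sb; split.
- by rewrite -size_eq0 size_rev size_map size_eq0.
- by move=> b; rewrite mem_rev => /mapP[b' /eb eb' ->]; apply: ear_rev.
- by rewrite -rev_flatten rev_uniq.
- rewrite rev_sorted sorted_map (eq_sorted (e' := link)) // => b b' /=.
  by rewrite /link head_rev_last last_rev_head e_sym.
Qed.

Lemma path_flatten b (bs : seq (seq T)) : (forall b', b' \in bs -> ear b') ->
  path link b bs -> path e (last u b) (flatten bs).
Proof.
elim: bs b => //= c bs IH b eb /andP[bc pc].
have ec : ear c by apply: eb; rewrite mem_head.
have IHc := IH c (fun b' h => eb b' (mem_behead (s := c :: bs) h)) pc.
have [sc _ _ _ _] := ec; move: bc; rewrite /link cat_path.
case: c {eb pc} sc IHc ec => [|x c] /= sc; first by move=> _ /ear_neq0.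
by rewrite sc => -> _ ->.
Qed.

Lemma ring_sorted bs : ring bs -> sorted e (flatten bs).
Proof.
case: bs => // b bs [_ eb _ pb].
have pf := path_flatten (fun b' h => eb b' (mem_behead (s := b :: bs) h)) pb.
have ebb : ear b by apply: eb; rewrite mem_head.
case: b {eb pb} ebb (ear_neq0 ebb) pf => // x b [sb _ _ _ _] _ pf.
by rewrite /= cat_path; apply/andP; split.
Qed.

Lemma ring_head bs : ring bs -> e u (head u (flatten bs)).
Proof.
case: bs => [[] // | b bs] [_ eb _ _].
have ebb : ear b by apply: eb; rewrite mem_head.
by case: b {eb} ebb (ear_neq0 ebb) => // x b [].
Qed.

Lemma ring_last bs : ring bs -> e u (last u (flatten bs)).
Proof. by move/ring_rev/ring_head; rewrite -rev_flatten head_rev_last. Qed.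

Lemma notin_ring bs : ring bs -> u \notin flatten bs.
Proof.
by case=> _ eb _ _; apply/negP => /flattenP[b /eb[_ _ _ /negP nub _]].
Qed.

Lemma path_graph_cycle s : uniq s -> u \notin s -> sorted e s -> 1 < size s ->
  e u (head u s) -> e u (last u s) -> graph_cycle e (u :: s).
Proof.
rewrite /graph_cycle /ucycleb; case: s => // x s us nus ps s1 ux ul.
rewrite cons_uniq nus us ltnS s1 /= rcons_path; move: ps ux ul => /= -> -> ul.
by rewrite /= e_sym ul.
Qed.

Lemma ring_cycle bs : ring bs -> 1 < size (flatten bs) ->
  graph_cycle e (u :: flatten bs).
Proof.
move=> rb s1; have [_ _ ub _] := rb.
by apply: path_graph_cycle => //; [apply: notin_ring | apply: ring_sorted
  | apply: ring_head | apply: ring_last].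
Qed.

(* If the new ear sees neither cycle neighbour of [u], these two are adjacent:
   close the cycle without [u] and use [u] to return from the new ear. *)
Lemma ring_insert_before s1 b s2 g : ring (s1 ++ b :: s2) -> ear g ->
  uniq (g ++ flatten (s1 ++ b :: s2)) -> link g b ->
  exists2 bs, ring bs & perm_eq (flatten bs) (g ++ flatten (s1 ++ b :: s2)).
Proof.
set bs := s1 ++ b :: s2 => rb eg ug gb.
have [bs0 eb ub sb] := rb.
have front : link g (head [::] bs) ->
  exists2 bs', ring bs' & perm_eq (flatten bs') (g ++ flatten bs).
  move=> gh; exists (g :: bs) => //; split=> //.
  - by move=> b'; rewrite inE => /predU1P[-> | /eb].
  - by case: bs bs0 sb gh {rb eb ub ug} => //= c bs _ -> ->.
case: s1 @bs rb ug bs0 eb ub sb front => [|h s1] bs rb ug bs0 eb ub sb front.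
  exact: front.
case gh: (link g h); first exact: front.
have eh : ear h by apply: eb; rewrite mem_head.
have lb : last b s2 \in bs by rewrite /bs mem_cat mem_last orbT.
have el : ear (last b s2) by apply: eb.
have lbs : last h (s1 ++ b :: s2) = last b s2 by rewrite last_cat.
case gl: (e (last u g) (last u (last b s2))).
  have pbs : perm_eq (flatten (rcons bs (rev g))) (g ++ flatten bs).
    by rewrite flatten_rcons perm_catC perm_cat2r perm_rev.
  exists (rcons bs (rev g)) => //; split=> //.
  - by move=> b'; rewrite mem_rcons inE => /predU1P[-> | /eb //]; apply: ear_rev.
  - by rewrite (perm_uniq pbs).
  - by rewrite /= rcons_path [path _ _ _]sb lbs /link head_rev_last e_sym gl.
(* There is no claw at [u] with leaves [last u g], [head u h] and the end of the ring. The first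
   leaf sees neither of the others, so these two are adjacent. *)
have hl : e (last u (last b s2)) (head u h).
  have hb := mem_head_ear eh; have hbl := mem_last_ear el.
  have hg := mem_last_ear eg.
  have [_ uhh _ _ _] := eh; have [_ _ ull _ _] := el; have [_ _ ug1 _ _] := eg.
  have dhl : head u h != last u (last b s2).
    move: ub; rewrite /= cat_uniq => /and3P[_ /hasPn hn _].
    apply: contraTneq hb => ->; apply: hn; apply/flattenP.
    by exists (last b s2); rewrite // mem_cat mem_last orbT.
  have disj x : x \in flatten bs -> last u g != x.
    move=> xb; apply: contraTneq hg => ->.
    by move: ug; rewrite cat_uniq => /and3P[_ /hasPn hn _]; apply: hn.
  have dh : last u g != head u h.
    by apply: disj; apply/flattenP; exists h; rewrite // mem_head.
  have dl : last u g != last u (last b s2).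
    by apply: disj; apply/flattenP; exists (last b s2).
  have := claw_edge ug1 uhh ull dh dl dhl.
  by move: gh; rewrite /link gl => -> /=; rewrite e_sym.
(* The closed-up ring is cut just before [b]: [u] now sits between the ear preceding [b] and [g]. *)
have pbs : perm_eq (flatten (g :: (b :: s2) ++ h :: s1)) (g ++ flatten bs).
  rewrite -cat1s flatten_cat [flatten [:: g]]/= cats0 perm_cat2l.
  by rewrite perm_flatten // perm_catC.
exists (g :: (b :: s2) ++ h :: s1) => //; split=> //.
- move=> b'; rewrite inE => /predU1P[-> // | b'in]; apply: eb.
  by move: b'in; rewrite !mem_cat orbC.
- by rewrite (perm_uniq pbs).
- move: sb; rewrite /bs /= !cat_path /= gb => /andP[-> /andP[_ ->]].
  by rewrite /= andbT.
Qed.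

(** Neighbours of [u] occur only as ends of ears, so after reversing the ring or [g] if needed, [y]
    ends [g] and [x] starts an ear of the ring. *)
Lemma ring_insert bs g x y : ring bs -> ear g -> uniq (g ++ flatten bs) ->
  x \in flatten bs -> e u x -> y \in g -> e u y -> e x y ->
  exists2 bs', ring bs' & perm_eq (flatten bs') (g ++ flatten bs).
Proof.
move=> rb eg ug xbs ux yg uy xy.
wlog xh : bs rb ug xbs / exists2 b, b \in bs & x = head u b.
  move=> IH; have [b bbs xb] := flattenP xbs; have [_ eb _ _] := rb.
  have [_ _ _ _ /(_ x xb ux)[xh | xl]] := eb b bbs.
    by apply: IH => //; exists b.
  have pr : perm_eq (flatten (rev (map rev bs))) (flatten bs).
    by rewrite -rev_flatten perm_rev.
  have pg : perm_eq (g ++ flatten (rev (map rev bs))) (g ++ flatten bs).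
    by rewrite perm_cat2l.
  have [] := IH (rev (map rev bs)).
  - exact: ring_rev.
  - by rewrite (perm_uniq pg).
  - by rewrite (perm_mem pr).
  - by exists (rev b); rewrite ?mem_rev ?map_f // head_rev_last.
  - by move=> bs' rb' /perm_trans/(_ pg) pb'; exists bs'.
have [b bbs xb] := xh.
wlog yl : g eg ug yg / y = last u g.
  move=> IH; have [_ _ _ _ /(_ y yg uy)[yh | yl]] := eg; last exact: IH.
  have pg : perm_eq (rev g ++ flatten bs) (g ++ flatten bs).
    by rewrite perm_cat2r perm_rev.
  have [] := IH (rev g).
  - exact: ear_rev.
  - by rewrite (perm_uniq pg).
  - by rewrite mem_rev.
  - by rewrite last_rev_head.
  - by move=> bs' rb' /perm_trans/(_ pg) pb'; exists bs'.
case/splitPr: bs / bbs rb ug xbs xh => s1 s2 rb ug _ _.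
by apply: ring_insert_before => //; rewrite /link -yl -xb e_sym.
Qed.

(** * Dominating rings *)

Definition nbr (s : seq T) : nat := count (e u) s.
Definition far (s : seq T) : nat := count (predC (e u)) s.

Lemma nbr_far s : nbr s + far s = size s.
Proof. exact: count_predC. Qed.

Lemma nbr_cat s t : nbr (s ++ t) = nbr s + nbr t.
Proof. exact: count_cat. Qed.

Lemma far_cat s t : far (s ++ t) = far s + far t.
Proof. exact: count_cat. Qed.

Lemma far_nbrs s : all (e u) s -> far s = 0.
Proof.
move=> /allP us; apply/eqP; rewrite -leqn0 leqNgt -has_count.
by apply/hasPn => x /us /= ->.
Qed.

Lemma perm_nbr s t : perm_eq s t -> nbr s = nbr t.
Proof. by move/permP=> st; apply: st. Qed.

Lemma perm_far s t : perm_eq s t -> far s = far t.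
Proof. by move/permP=> st; apply: st. Qed.

Lemma nbr_degree s :
  uniq s -> nbr s + size [seq v <- enum T | e u v & v \notin s] = degree e u.
Proof.
move=> us; rewrite /nbr /degree -size_filter -size_cat cardsE cardE.
apply/perm_size/uniq_perm.
- rewrite cat_uniq; apply/and3P; split; try exact/filter_uniq/enum_uniq.
    exact: filter_uniq.
  apply/hasPn => v.
  rewrite mem_filter => /andP[/andP[_ nv] _] /=.
  by rewrite mem_filter negb_and nv orbT.
- exact: enum_uniq.
- move=> v; rewrite mem_cat 2!mem_filter !mem_enum !inE.
  by rewrite [RHS]unfold_in; case: (e u v); case: (v \in s).
Qed.

Definition dominating (p : seq T) : Prop :=
  forall v, e u v -> v \notin p -> exists2 x, x \in p & e u x && e x v.

Lemma dominating_sub p p' :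
  {subset p <= p'} -> dominating p -> dominating p'.
Proof.
move=> sp dp v uv vp'; have [|x xp xv] := dp v uv; last by exists x; first exact: sp.
by apply: contraNN vp' => /sp.
Qed.

(** The head of an ear off the ring is in [N(u)], so domination provides a place to insert the ear;
    a larger ring still dominates. *)
Lemma ring_absorb bs (gs : seq (seq T)) : ring bs -> dominating (flatten bs) ->
  (forall g, g \in gs -> ear g) -> uniq (flatten gs ++ flatten bs) ->
  exists2 bs', ring bs' & perm_eq (flatten bs') (flatten gs ++ flatten bs).
Proof.
move=> rb db; elim: gs => [|g gs IH] eg; first by exists bs.
rewrite /= -catA => ug.
have [|| bs1 rb1 pb1] := IH.
- by move=> g' g'gs; apply: eg; rewrite inE g'gs orbT.
- by move: ug; rewrite cat_uniq => /and3P[].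
have egg : ear g by apply: eg; rewrite mem_head.
have pg : perm_eq (g ++ flatten bs1) (g ++ flatten gs ++ flatten bs).
  by rewrite perm_cat2l.
have ug1 : uniq (g ++ flatten bs1) by rewrite (perm_uniq pg).
have hg := mem_head_ear egg; have [_ uh _ _ _] := egg.
have [||x xb /andP[ux xh]] := @dominating_sub (flatten bs) (flatten bs1) _ db _ uh.
- by move=> x xb; rewrite (perm_mem pb1) mem_cat xb orbT.
- apply: contraTN ug1 => hb; rewrite cat_uniq.
  by apply/negP => /and3P[_ /hasPn/(_ _ hb)/negP].
have [bs' rb' pb'] := ring_insert rb1 egg ug1 xb ux hg uh xh.
by exists bs'; last exact: perm_trans pb' pg.
Qed.

Definition has_cycle (k : nat) : bool := [exists c : k.-tuple T, graph_cycle e c].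

Lemma graph_cycle_has c : graph_cycle e c -> has_cycle (size c).
Proof. by move=> cc; apply/existsP; exists (in_tuple c). Qed.

(** Each neighbour of [u] off the ring is a one-vertex ear. Absorbing [k.-1 - size (flatten bs)] of
    them gives length [k], as [u] counts too. *)
Lemma ring_has_cycle bs k : ring bs -> dominating (flatten bs) ->
  2 < k -> size (flatten bs) < k <= far (flatten bs) + (degree e u).+1 ->
  has_cycle k.
Proof.
move=> rb db k2 /andP[ltk lek]; have [_ _ ub _] := rb.
set s := [seq v <- enum T | e u v & v \notin flatten bs].
have sz : size s = degree e u - nbr (flatten bs).
  by rewrite -(nbr_degree ub) addKn.
have nd : nbr (flatten bs) <= degree e u by rewrite -(nbr_degree ub) leq_addr.
set t := take (k.-1 - size (flatten bs)) s.
have st : size t = k.-1 - size (flatten bs).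
  rewrite size_takel // sz -nbr_far; lia.
have tP v : v \in t -> e u v && (v \notin flatten bs).
  by move/mem_take; rewrite mem_filter => /andP[].
have [||bs' rb' pb'] := @ring_absorb bs [seq [:: v] | v <- t] rb db.
- by move=> g /mapP[v /tP/andP[uv _] ->]; apply: ear1.
- rewrite flatten_seq1 cat_uniq ub andbT.
  apply/andP; split; first exact/take_uniq/filter_uniq/enum_uniq.
  by apply/hasPn => v vb; apply: contraTN vb => /tP/andP[].
have sb' : size (flatten bs') = k.-1.
  by rewrite (perm_size pb') flatten_seq1 size_cat st subnK //; lia.
have -> : k = size (u :: flatten bs') by rewrite /= sb' (ltn_predK k2).
by apply: graph_cycle_has; apply: ring_cycle; rewrite // sb'; lia.
Qed.

(** Three cases: [z] is already on the ring, or it is inserted alone and recorded in [t], or it lies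
    on a pending ear, which is inserted whole. *)
Lemma ring_absorb_vertex bs (gs : seq (seq T)) x z : ring bs ->
  (forall g, g \in gs -> ear g) -> uniq (flatten gs ++ flatten bs) ->
  x \in flatten bs -> e u x -> e u z -> e x z ->
  exists bs' gs' t,
    [/\ ring bs', forall g, g \in gs' -> ear g,
        z \in flatten bs' /\ {subset flatten bs <= flatten bs'},
        uniq (flatten gs' ++ flatten bs') /\
        perm_eq (flatten gs' ++ flatten bs') (t ++ flatten gs ++ flatten bs) &
        all (e u) t /\ size t <= 1].
Proof.
move=> rb eg ug xb ux uz xz.
case zb: (z \in flatten bs).
  by exists bs, gs, [::]; split=> //; split.
case zg: (z \in flatten gs); last first.
  have uz1 : uniq ([:: z] ++ flatten bs).
    by rewrite /= zb; move: ug; rewrite cat_uniq => /and3P[].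
  have [bs' rb' pb'] := ring_insert rb (ear1 uz) uz1 xb ux (mem_head z _) uz xz.
  have pp : perm_eq (flatten gs ++ flatten bs') ([:: z] ++ flatten gs ++ flatten bs).
    by rewrite perm_sym perm_catCA perm_cat2l perm_sym.
  exists bs', gs, [:: z]; split=> //; last by rewrite /= uz.
  - split; first by rewrite (perm_mem pb') mem_head.
    by move=> y yb; rewrite (perm_mem pb') inE yb orbT.
  - by split; rewrite // (perm_uniq pp) /= ug mem_cat zb zg.
have [g ggs zg'] := flattenP zg; have ge := eg g ggs.
have pg := perm_to_rem ggs.
have pp : perm_eq (flatten gs ++ flatten bs)
                  (flatten (rem g gs) ++ g ++ flatten bs).
  by rewrite perm_sym perm_catCA catA perm_cat2r perm_sym (perm_flatten pg).
have ug1 : uniq (g ++ flatten bs).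
  by move: ug; rewrite (perm_uniq pp) cat_uniq => /and3P[].
have [bs' rb' pb'] := ring_insert rb ge ug1 xb ux zg' uz xz.
have pp' : perm_eq (flatten (rem g gs) ++ flatten bs') (flatten gs ++ flatten bs).
  by rewrite perm_sym (perm_trans pp) // perm_cat2l perm_sym.
exists bs', (rem g gs), [::]; split=> //.
- by move=> g' /mem_rem/eg.
- split; first by rewrite (perm_mem pb') mem_cat zg'.
  by move=> y yb; rewrite (perm_mem pb') mem_cat yb orbT.
- by split; rewrite // (perm_uniq pp').
Qed.

(** In the graph induced on [N(u)], either [x] sees all other vertices or some [l] lies at distance
    two from it, through [z]. *)
Definition reaching (x : T) : Prop :=
  (forall v, e u v -> v != x -> e x v) \/
  exists z l, [/\ e u z, e u l, e x z, e z l & (l != x) && ~~ e x l].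

(** Any disjoint ears can be merged with [q] into a dominating ring. The slack of two pays for the
    vertices [z] and [l] of [reaching], when they are on no ear. *)
Definition seed (q : seq T) : Prop := forall gs : seq (seq T),
  (forall g, g \in q :: gs -> ear g) -> uniq (flatten (q :: gs)) ->
  exists bs, [/\ ring bs, dominating (flatten bs),
    far (flatten bs) = far (flatten (q :: gs)) &
    nbr (flatten bs) <= (nbr (flatten (q :: gs))).+2].

Lemma ring1 q : ear q -> uniq q -> ring [:: q].
Proof.
move=> eq uq; split=> //; first by move=> b; rewrite inE => /eqP->.
by rewrite /= cats0.
Qed.

Lemma dominating_seed q : dominating q -> seed q.
Proof.
move=> dq gs eg ug.
have eq : ear q by apply: eg; rewrite mem_head.
have egs g : g \in gs -> ear g by move=> ggs; apply: eg; rewrite inE ggs orbT.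
have pq : perm_eq (flatten gs ++ flatten [:: q]) (flatten (q :: gs)).
  by rewrite /= cats0 perm_catC.
have uq : uniq (flatten gs ++ flatten [:: q]) by rewrite (perm_uniq pq).
have rq : ring [:: q].
  by apply: ring1 => //; move: ug; rewrite /= cat_uniq => /and3P[].
have dq' : dominating (flatten [:: q]) by rewrite /= cats0.
have [bs rb pb] := ring_absorb rq dq' egs uq.
exists bs; split=> //.
- by apply: dominating_sub dq' => y yq; rewrite (perm_mem pb) mem_cat yq orbT.
- by rewrite (perm_far pb) (perm_far pq).
- by rewrite (perm_nbr pb) (perm_nbr pq) -addn2 leq_addr.
Qed.

(* [x = head u q], [z] and [l] together dominate the neighbourhood of [u]: a
   vertex missed by [x] is adjacent to [l]. *)
Lemma reaching_seed q : reaching (head u q) -> seed q.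
Proof.
move=> rx gs eg ug; have eq : ear q by apply: eg; rewrite mem_head.
have egs g : g \in gs -> ear g by move=> ggs; apply: eg; rewrite inE ggs orbT.
have hq := mem_head_ear eq; have [_ ux _ _ _] := eq.
set x := head u q in rx hq ux.
have rq : ring [:: q].
  by apply: ring1 => //; move: ug; rewrite /= cat_uniq => /and3P[].
have pq : perm_eq (flatten gs ++ flatten [:: q]) (flatten (q :: gs)).
  by rewrite /= cats0 perm_catC.
have uq : uniq (flatten gs ++ flatten [:: q]) by rewrite (perm_uniq pq).
have hq' : x \in flatten [:: q] by rewrite /= cats0.
case: rx => [rx | [z [l [uz ul xz zl /andP[lx nxl]]]]].
  apply: (dominating_seed _ eg ug) => v uv vq; exists x => //; rewrite ux rx //.
  by apply: contraNneq vq => ->.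
have [b1 [g1 [t1 [rb1 eg1 [zb1 sb1] [ub1 pb1] [at1 st1]]]]] :=
  ring_absorb_vertex rq egs uq hq' ux uz xz.
have [b2 [g2 [t2 [rb2 eg2 [lb2 sb2] [ub2 pb2] [at2 st2]]]]] :=
  ring_absorb_vertex rb1 eg1 ub1 zb1 uz ul zl.
have d2 : dominating (flatten b2).
  move=> v uv vb; have xb2 := sb2 _ (sb1 _ hq').
  have vx : v != x by apply: contraNneq vb => ->.
  have vl : v != l by apply: contraNneq vb => ->.
  case xv: (e x v); first by exists x; rewrite // ux xv.
  exists l; rewrite // ul /=; have := claw_edge ux ul uv.
  by rewrite (negPf nxl) xv ![x == _]eq_sym lx vx [l == _]eq_sym vl => /(_ isT isT isT).
have [bs rb pb] := ring_absorb rb2 d2 eg2 ub2.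
have pf : perm_eq (flatten bs) (t2 ++ t1 ++ flatten (q :: gs)).
  apply: (perm_trans pb); apply: (perm_trans pb2); rewrite perm_cat2l.
  by apply: (perm_trans pb1); rewrite perm_cat2l.
exists bs; split=> //.
- by apply: dominating_sub d2 => y yb; rewrite (perm_mem pb) mem_cat yb orbT.
- by rewrite (perm_far pf) far_cat far_cat (far_nbrs at1) (far_nbrs at2).
- rewrite (perm_nbr pf) nbr_cat nbr_cat addnA -addn2 addnC leq_add2l.
  exact: leq_add (leq_trans (count_size _ _) st2) (leq_trans (count_size _ _) st1).
Qed.

(** * Covering the non-neighbours by ears *)

(** Each long ear uses two vertices of [N(u)] and gains at least one outside it; the gap estimates
    rest on this balance. *)
Definition long_ear (q : seq T) : Prop := [/\ ear q, nbr q = 2 & 0 < far q].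

Lemma long_ear_intro x s z : sorted e (x :: rcons s z) ->
  u \notin x :: rcons s z -> e u x -> e u z -> ~~ has (e u) s -> s != [::] ->
  long_ear (x :: rcons s z).
Proof.
move=> sq uq ux uz ns s0.
have cs : count (e u) s = 0 by apply/eqP; rewrite -leqn0 leqNgt -has_count.
have nq : nbr (x :: rcons s z) = 2.
  by rewrite /nbr /= -cats1 count_cat /= cs ux uz.
split=> //; last first.
  have := nbr_far (x :: rcons s z); rewrite nq /= size_rcons => /eqP.
  by rewrite !addSn !eqSS add0n => /eqP ->; case: (s) s0.
split=> //; first by rewrite /= last_rcons.
move=> y; rewrite inE mem_rcons inE /= last_rcons => /or3P[/eqP->|/eqP->|ys] uy.
- by left.
- by right.
- by case/negP: ns; apply/hasP; exists y.
Qed.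

Definition two_cliques (col : T -> bool) : Prop :=
  forall x y, e u x -> e u y -> x != y -> e x y = (col x == col y).

(** The colour of the head is recorded so that, in the induction, the path can be attached behind a
    vertex of the same clique. The empty path serves only [m = 0]. *)
Definition shrinkable (col : T -> bool) (c : seq T) (m : nat) : Prop :=
  exists s, [/\ size s = m, uniq s, {subset s <= c}, sorted e s &
    s = [::] \/ [/\ e u (head u s), e u (last u s) &
                    col (head u s) = col (head u c)]].

(* A neighbour of [u] between two non-neighbours can be skipped, by
   claw-freeness.  If the neighbourhood is two cliques, every deletion made on
   the way leaves a path whose ends are neighbours of [u]. *)
Lemma long_ear_decomposition c : sorted e c -> uniq c -> u \notin c ->
  e u (head u c) -> e u (last u c) ->
  exists qs, [/\ forall q, q \in qs -> long_ear q,
    uniq (flatten qs),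
    {subset flatten qs <= c},
    forall x, x \in c -> ~~ e u x -> x \in flatten qs &
    forall col, two_cliques col ->
      ((exists2 q, q \in qs & col (head u q) != col (last u q)) \/
       (forall y, y \in flatten qs -> e u y -> col y = col (head u c))) /\
      (forall m, size (flatten qs) <= m <= size c -> shrinkable col c m)].
Proof.
have [n] := ubnP (size c); elim: n c => // n IH [|x c1] /=; first by rewrite e_irr.
rewrite ltnS => szc pc /andP[xc1 uc1].
rewrite inE negb_or => /andP[nux uc1'] ux ul.
have self col : shrinkable col (x :: c1) (size c1).+1.
  exists (x :: c1); split=> //=; first by rewrite xc1.
  by right.
case: c1 => [|y c2] in szc pc xc1 uc1 uc1' ul self *.
  exists [::]; split=> //= [y|col _].
    by rewrite inE => /eqP ->; rewrite ux.
  split; first by right.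
  move=> [|[|m]] // _; exists [::]; split=> //; by left.
(* If [y] is in [N(u)], no ear starts at [x], which is dropped. Being adjacent, [x] and [y] have the
   same colour. *)
case uy: (e u y).
  have pc2 : path e y c2 by case/andP: pc.
  have [qs [lq uq sq fq cq]] := IH (y :: c2) szc pc2 uc1 uc1' uy ul.
  exists qs; split=> //.
  - by move=> z /sq zc; rewrite inE zc orbT.
  - move=> z; rewrite inE => /predU1P[-> | zc]; first by rewrite ux.
    exact: fq.
  - move=> col tc; have [hc hm] := cq col tc.
    have cxy : col y = col x.
      have xy : x != y by apply: contraNneq xc1 => ->; rewrite mem_head.
      by apply/esym/eqP; rewrite -(tc x y) //; case/andP: pc.
    split; first by rewrite /= -cxy.
    move=> m /andP[m1]; rewrite leq_eqVlt => /predU1P[-> // | m2].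
    have [|s [ss us sub ps es]] := hm m; first by rewrite m1.
    exists s; split=> //; first by move=> z /sub zc; rewrite inE zc orbT.
    by case: es => [->|[h1 h2 /= h3]]; [left | right; split; rewrite // h3].
(* Otherwise the path is followed to its next vertex [z] in [N(u)], which gives a candidate ear
   [q]. *)
have hN : has (e u) (y :: c2).
  by apply/hasP; exists (last y c2); first exact: mem_last.
have [rr [z [c3 [def_c uz nrr]]]] : exists rr z c3,
    [/\ y :: c2 = rcons rr z ++ c3, e u z & ~~ has (e u) rr].
  by case: (split_find hN) => z rr c3; exists rr, z, c3.
have rr0 : rr != [::].
  by apply: contraFneq uy => rr0; move: def_c uz; rewrite rr0 /= => -[-> _].
rewrite [last x _](_ : _ = last y c2) // in ul.
have {}ul : e u (last z c3).
  by move: ul; rewrite -[last y c2]/(last x (y :: c2)) def_c last_cat last_rcons.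
move: szc pc xc1 uc1 uc1' self; rewrite def_c {y c2 uy hN def_c}.
move=> szc pc xc1 uc1 uc1' self.
set q := x :: rcons rr z.
have pq : path e x (rcons rr z) by move: pc; rewrite cat_path => /andP[].
have pc3 : path e z c3 by move: pc; rewrite cat_path last_rcons => /andP[].
have [uq3 [dq3 uc3]] : uniq q /\ ~~ has (mem q) c3 /\ uniq c3.
  have : uniq (q ++ c3) by rewrite /= xc1.
  by rewrite cat_uniq => /and3P[].
have nuq : u \notin q ++ c3 by rewrite /= inE negb_or nux.
have lq : long_ear q.
  apply: long_ear_intro => //.
  by move: nuq; rewrite mem_cat negb_or => /andP[].
have nuc3 : u \notin c3 by move: nuq; rewrite mem_cat negb_or => /andP[].
case: c3 => [|w c4] in ul szc pc xc1 uc1 uc1' self pc3 dq3 uc3 nuq nuc3 *.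
  exists [:: q]; rewrite /= !cats0 in self *; split=> //.
  - by move=> q'; rewrite inE => /eqP ->.
  - move=> col tc; split.
      case cxz: (col x == col z); last first.
        by left; exists q; rewrite ?mem_head //= last_rcons cxz.
      right=> y yq uy; have [[_ _ _ _ endq] _ _] := lq.
      by case: (endq y yq uy) => ->; rewrite //= last_rcons (eqP cxz).
    by move=> m; rewrite -eqn_leq => /eqP <-.
(* With [w] in [N(u)], the ear [q] is kept and the induction restarts at [w], which has the colour
   of its neighbour [z]. *)
case uw: (e u w).
  have szc3 : size (w :: c4) < n.
    by apply: leq_trans szc; rewrite ltnS size_cat leq_addl.
  have pc4 : path e w c4 by case/andP: pc3.
  have [qs [lqs uqs sqs fqs cqs]] := IH (w :: c4) szc3 pc4 uc3 nuc3 uw ul.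
  exists (q :: qs); split.
  - by move=> q'; rewrite inE => /predU1P[-> | /lqs].
  - rewrite [flatten _]/= -cat_cons -/q cat_uniq uq3 uqs andbT.
    by apply/hasPn => v /sqs vc; move/hasPn: dq3; apply.
  - move=> v; rewrite [flatten _]/= -!cat_cons -/q !mem_cat.
    by case: (v \in q) => //= /sqs.
  - move=> v; rewrite [flatten _]/= -!cat_cons -/q !mem_cat.
    by case: (v \in q) => //=; apply: fqs.
  - move=> col tc; have [hc hm] := cqs col tc.
    have zq : z \in q by rewrite inE mem_rcons mem_head orbT.
    have nz v : v \in w :: c4 -> z != v.
      by move=> vc; apply: contraTneq zq => ->; move/hasPn: dq3; apply.
    have czw : col z = col w.
      by apply/eqP; rewrite -(tc z w) ?nz ?mem_head //; case/andP: pc3.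
    split.
      case cxz: (col x == col z); last first.
        by left; exists q; rewrite ?mem_head //= last_rcons cxz.
      case: hc => [[q' q'q cq'] | hc].
        by left; exists q'; rewrite // inE q'q orbT.
      right=> v; rewrite [flatten _]/= -cat_cons -/q mem_cat => /orP[vq uv | vq uv].
        have [[_ _ _ _ endq] _ _] := lq.
        by case: (endq v vq uv) => ->; rewrite //= last_rcons (eqP cxz).
      by rewrite (hc v vq uv) /= (eqP cxz).
    move=> m; rewrite [flatten _]/= -!cat_cons -/q !size_cat => /andP[m1 m2].
    have mq : size q <= m by apply: leq_trans m1; apply: leq_addr.
    have [|s [ss us sub ps es]] := hm (m - size q).
      by rewrite leq_subRL // m1 leq_subLR.
    exists (q ++ s); split.
    + by rewrite size_cat ss subnKC.
    + rewrite cat_uniq uq3 us andbT.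
      by apply/hasPn => v /sub vc; move/hasPn: dq3; apply.
    + move=> v; change (v \in q ++ s -> v \in q ++ w :: c4); rewrite !mem_cat.
      by case: (v \in q) => //= /sub.
    + rewrite /= cat_path pq last_rcons /=.
      (* The head of [s] has the colour of [w], hence of [z], so [z] sees it. *)
      case: es => [-> // | [h1 h2 h3]].
      case: s {ss us} sub ps h1 h2 h3 => //= v s sub -> h1 _ h3.
      by rewrite tc // ?h3 ?czw ?eqxx // nz // sub // mem_head.
    + right; split=> //; rewrite last_cat /= last_rcons.
      by case: es => [-> // | [h1 h2 h3]]; case: (s) h2.
(* Now [z] lies between the non-neighbours [p] and [w] of [u]. Since [u], [p], [w] form no claw at
   [z], [p] sees [w], and the induction runs on the path without [z]. *)
case/lastP: rr => // rr p in rr0 nrr q pq szc pc xc1 uc1 uc1' self uq3 dq3 nuq lq *.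
have pz : path e x (rcons rr p) /\ e p z.
  by move: pq; rewrite rcons_path last_rcons => /andP[].
have zw : e z w by case/andP: pc3.
have sub : subseq (x :: rcons rr p ++ w :: c4)
                  (x :: rcons (rcons rr p) z ++ w :: c4).
  by rewrite -!cat_cons cat_subseq // -rcons_cons subseq_rcons.
have uc : uniq (x :: rcons (rcons rr p) z ++ w :: c4) by rewrite /= xc1.
have p_q : p \in q by rewrite /q inE mem_rcons inE mem_rcons mem_head !orbT.
have pw : e p w.
  have up : ~~ e u p.
    by move/hasPn: nrr; apply; rewrite mem_rcons mem_head.
  have npw : p != w.
    apply: contraTneq dq3 => <-; rewrite negbK; apply/hasP; exists p.
      exact: mem_head.
    exact: p_q.
  have := @claw_edge z u p w; rewrite (e_sym z u) (e_sym z p) uz pz.2 zw npw.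
  rewrite (negPf up) uw; apply=> //.
    by apply: contraNneq nuq => ->; rewrite mem_cat p_q.
  by apply: contraNneq nuc3 => ->; rewrite mem_head.
have pc' : path e x (rcons rr p ++ w :: c4).
  by rewrite cat_path last_rcons pz.1 /= pw; case/andP: pc3.
have szc' : size (x :: rcons rr p ++ w :: c4) < n.
  by move: szc; rewrite !size_cat /= size_cat !size_rcons.
have nuc' : u \notin x :: rcons rr p ++ w :: c4.
  by apply: contra nuq => /(mem_subseq sub).
have ul' : e u (last u (x :: rcons rr p ++ w :: c4)) by rewrite /= last_cat.
have [qs [lqs uqs sqs fqs cqs]] :=
  IH (x :: rcons rr p ++ w :: c4) szc' pc' (subseq_uniq sub uc) nuc' ux ul'.
exists qs; split=> //.
- by move=> v /sqs/(mem_subseq sub).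
- move=> v vc uv; apply: fqs => //; move: vc.
  have vz : (v == z) = false by apply: contraNF uv => /eqP ->.
  by rewrite !in_cons !mem_cat mem_rcons in_cons vz.
- move=> col tc; have [hc hm] := cqs col tc; split=> // m /andP[m1].
  rewrite leq_eqVlt => /predU1P[-> // | m2].
  have [|s [ss us sub' ps es]] := hm m.
    by rewrite m1; move: m2; rewrite /= !size_cat !size_rcons ltnS.
  by exists s; split=> // v /sub'/(mem_subseq sub).
Qed.

(** * Intervals of cycle lengths *)

Lemma has_cycle_leq k : has_cycle k -> k <= #|T|.
Proof.
case/existsP=> c /andP[_ /andP[_ uc]].
by rewrite -(size_tuple c) -(card_uniqP uc) max_card.
Qed.

Lemma leq_card_spectrum (s : seq nat) :
  uniq s -> {in s, forall k, has_cycle k} -> size s <= #|cycle_spectrum e|.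
Proof.
move=> us hs; have bs k : k \in s -> (inord k : 'I_(#|T|.+1)) = k :> nat.
  by move=> /hs/has_cycle_leq ks; rewrite inordK.
rewrite cardE -(size_map (@inord #|T|)); apply: uniq_leq_size.
  rewrite map_inj_in_uniq // => i j /bs bi /bs bj /(congr1 val) /=.
  by rewrite bi bj.
move=> i /mapP[k ks ->]; rewrite mem_enum inE.
by rewrite -/(has_cycle _) bs //; apply: hs.
Qed.

Definition covers (lo hi : nat) : Prop :=
  forall k, lo <= k <= hi -> has_cycle k.

(** If the intervals neither overlap nor abut, they are disjoint and the numbers of their lengths
    add up. *)
Lemma covers_join t l t' : covers 3 t -> covers l t' ->
  covers 3 t' \/ t - 2 + (t'.+1 - l) <= #|cycle_spectrum e|.
Proof.
move=> ct cl; have [lt | tl] := leqP l t.+1.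
  left=> k /andP[k3 kt]; have [kt' | tk] := leqP k t.
    by apply: ct; rewrite k3.
  by apply: cl; rewrite kt (leq_trans lt).
right; rewrite -(size_iota 3 (t - 2)) -(size_iota l (t'.+1 - l)) -size_cat.
apply: leq_card_spectrum.
  rewrite cat_uniq !iota_uniq andbT /=; apply/hasPn => k.
  by rewrite !mem_iota; lia.
move=> k; rewrite mem_cat !mem_iota => /orP[] hk; [apply: ct | apply: cl]; lia.
Qed.

Local Notation D := (degree e u).
Local Notation B := (uphalf (3 * D) - 2).

Lemma nbr_leq_degree s : uniq s -> nbr s <= D.
Proof. by move=> us; rewrite -(nbr_degree us) leq_addr. Qed.

Lemma long_ears_count (gs : seq (seq T)) : (forall g, g \in gs -> long_ear g) ->
  nbr (flatten gs) = 2 * size gs /\ size gs <= far (flatten gs).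
Proof.
elim: gs => // g gs IH lg.
have [|n1 n2] := IH; first by move=> g' g'gs; apply: lg; rewrite inE g'gs orbT.
have [|_ gn gf] := lg g; first exact: mem_head.
rewrite -cat1s flatten_cat nbr_cat far_cat /= cats0 n1 gn mulnS.
by split; last by rewrite -add1n leq_add.
Qed.

(** The ears have [2 * (size gs).+1] vertices in [N(u)] and the seed adds at most two, never
    exceeding [D] in all. The last unit of [+ 3] and of [D.+1] is [u]. *)
Lemma seed_covers q (gs : seq (seq T)) : seed q ->
  (forall g, g \in q :: gs -> long_ear g) -> uniq (flatten (q :: gs)) ->
  covers (far (flatten (q :: gs)) + minn (2 * (size gs).+1 + 3) D.+1)
         (far (flatten (q :: gs)) + D.+1).
Proof.
move=> sq lg ug k /andP[k1 k2].
have [|//|bs [rb db fb nb]] := sq gs; first by move=> g /lg[].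
have [nq _] := long_ears_count lg; rewrite [size _]/= in nq.
have nD := nbr_leq_degree ug; rewrite nq in nb nD.
have [_ _ ub _] := rb; have nD' := nbr_leq_degree ub.
have lb : nbr (flatten bs) < minn (2 * (size gs).+1 + 3) D.+1.
  by rewrite leq_min ltnS nD' andbT addn3 ltnS.
apply: (ring_has_cycle rb db).
  apply: leq_trans k1; apply: leq_trans (leq_addl _ _).
  by rewrite leq_min; move: D nD; clear; lia.
rewrite -nbr_far fb k2 andbT; apply: leq_trans k1.
by rewrite addnC -addnS leq_add2l.
Qed.

(** A gap yields at least [i + D] lengths, and also at least [2 * D - i - 4]. The first is enough
    when [i] is at least [uphalf D - 2], the second otherwise. *)
Lemma chain_step i r r' : i <= r -> 2 * i.+1 <= D -> covers 3 (r + D.+1) ->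
  covers (r' + minn (2 * i.+1 + 3) D.+1) (r' + D.+1) ->
  covers 3 (r' + D.+1) \/ B <= #|cycle_spectrum e|.
Proof.
move=> ir iD c1 c2; case: (covers_join c1 c2) => [|h]; [by left | right].
by apply: leq_trans h; move: D ir iD; clear; lia.
Qed.

(** Ears come in one at a time. Each one in use supplies a vertex outside [N(u)], as [chain_step]
    requires; [rcons] keeps the seed in front. *)
Lemma chain q (gs : seq (seq T)) : seed q ->
  (forall g, g \in q :: gs -> long_ear g) -> uniq (flatten (q :: gs)) ->
  covers 3 (far q + D.+1) ->
  covers 3 (far (flatten (q :: gs)) + D.+1) \/ B <= #|cycle_spectrum e|.
Proof.
move=> sq lg ug cq; elim/last_ind: gs => [|gs g IH] in lg ug *.
  by left; rewrite /= cats0.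
have fl : flatten (q :: rcons gs g) = flatten (q :: gs) ++ g.
  by rewrite -rcons_cons flatten_rcons.
have lg' h : h \in q :: gs -> long_ear h.
  by move=> hg; apply: lg; rewrite -rcons_cons mem_rcons inE hg orbT.
have ug' : uniq (flatten (q :: gs)).
  by move: ug; rewrite fl cat_uniq => /and3P[].
have [c|] := IH lg' ug'; last by right.
have [_ sz] := long_ears_count lg'; have [nq _] := long_ears_count lg.
have nD := nbr_leq_degree ug; rewrite nq in nD.
have cc := seed_covers sq lg ug.
rewrite size_rcons in cc; rewrite /= size_rcons in nD.
exact: chain_step sz nD c cc.
Qed.

(** * The two types of neighbourhoods *)

(** Each end of [q] sees the rest of its own clique. *)
Lemma bicoloured_dominating col q : two_cliques col -> ear q ->
  col (head u q) != col (last u q) -> dominating q.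
Proof.
move=> tc eq cq v uv vq; have [_ uh ul _ _] := eq.
have hq := mem_head_ear eq; have lq := mem_last_ear eq.
have vne x : x \in q -> x != v by move=> xq; apply: contraNneq vq => <-.
case cv: (col (head u q) == col v).
  by exists (head u q) => //; rewrite uh tc // vne.
exists (last u q) => //; rewrite ul tc //; last exact: vne.
by move: cq cv; case: (col _); case: (col _); case: (col v).
Qed.

(** If [x] is not reaching, it misses some [l] but has no vertex at distance two within [N(u)]. So
    its closed neighbourhood there is joined to nothing else, and excluding claws at [u] with third
    leaf [l] or [x] makes both sides cliques. *)
Lemma reaching_or_two_cliques :
  (forall x, e u x -> reaching x) \/
  exists col x y, [/\ two_cliques col, e u x, e u y & col x != col y].
Proof.
pose path3 x z l := [&& e u z, e u l, e x z, e z l, l != x & ~~ e x l].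
pose miss x l := [&& e u l, l != x & ~~ e x l].
case: (boolP [exists x, [&& e u x, [exists l, miss x l] &
                            ~~ [exists z, [exists l, path3 x z l]]]]).
  case/existsP=> x /and3P[ux /existsP[l /and3P[ul lx nxl]] npath].
  have np z v : e u z -> e u v -> e x z -> e z v -> v != x -> e x v.
    move=> uz uv xz zv vx; apply: contraNT npath => nxv.
    apply/existsP; exists z; apply/existsP; exists v.
    by apply/and5P; split=> //; rewrite vx.
  right; exists (fun y => (y == x) || e x y), x, l; split=> //; last first.
    by rewrite eqxx (negPf lx) (negPf nxl).
  move=> y y' uy uy' yy' /=.
  have [yx | yx] := eqVneq y x.
    rewrite yx in yy' *; rewrite [y' == x]eq_sym (negPf yy') /=.
    by case: (e x y').
  have [yx' | yx'] := eqVneq y' x.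
    rewrite yx' e_sym /=.
    by case: (e x y).
  rewrite /=; case xy: (e x y); case xy': (e x y').
  - have yl : y != l by apply: contraNneq nxl => <-.
    have yl' : y' != l by apply: contraNneq nxl => <-.
    case/or3P: (claw_edge uy uy' ul yy' yl yl') => [-> // | yl'' | yl''].
      by case/negP: nxl; apply: (np y).
    by case/negP: nxl; apply: (np y').
  - by apply: contraFF xy' => yy''; apply: (np y).
  - by apply: contraFF xy => yy''; apply: (np y') => //; rewrite e_sym.
  - rewrite eqxx; rewrite eq_sym in yx; rewrite eq_sym in yx'.
    by have := claw_edge ux uy uy' yx yx' yy'; rewrite xy xy'.
move=> nex; left=> x ux.
case: (boolP [exists z, [exists l, path3 x z l]]) => [/existsP[z /existsP[l]] | np].
  by case/and5P=> uz ul xz zl lx; right; exists z, l.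
left=> v uv vx; apply: contraNT nex => nxv; apply/existsP; exists x.
by rewrite ux np andbT; apply/existsP; exists v; apply/and3P.
Qed.

Lemma clique_sorted (s : seq T) :
  uniq s -> {in s &, forall x y, x != y -> e x y} -> sorted e s.
Proof.
elim: s => //= x [|y s] IH //= /andP[xs us] cs; apply/andP; split.
  apply: cs; rewrite ?inE ?eqxx ?orbT //.
  by apply: contraNneq xs => ->; rewrite mem_head.
by apply: IH => // a b ain bin; apply: cs; rewrite inE ?ain ?bin orbT.
Qed.

(** The larger colour class has at least half of [N(u)], and with [u] it is a clique. *)
Lemma two_cliques_covers col :
  two_cliques col -> exists2 a, uphalf D <= a & covers 3 a.+1.
Proof.
move=> tc; pose A b := [seq y <- enum T | e u y & col y == b].
have inA b y : (y \in A b) = e u y && (col y == b).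
  by rewrite mem_filter mem_enum andbT.
have sD : size (A true) + size (A false) = D.
  rewrite /degree cardsE cardE -size_cat; apply/perm_size/uniq_perm.
  - rewrite cat_uniq; apply/and3P; split; try exact/filter_uniq/enum_uniq.
    apply/hasPn => y; rewrite inA => /andP[_ /eqP cy] /=.
    by rewrite inA cy andbF.
  - exact: enum_uniq.
  - move=> y; rewrite mem_cat !inA mem_enum [RHS]unfold_in.
    by case: (e u y); case: (col y).
have [b bD] : exists b, uphalf D <= size (A b).
  have [h | h] := leqP (uphalf D) (size (A true)); first by exists true.
  by exists false; move: (size _) (size _) D sD h; clear; lia.
exists (size (A b)) => // k /andP[k3 kA].
pose s := take k.-1 (A b).
have ss : size s = k.-1 by rewrite size_takel //; move: k3 kA; clear; case: k.
have sP y : y \in s -> e u y && (col y == b).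
  by move/mem_take; rewrite inA.
have us : uniq s by exact/take_uniq/filter_uniq/enum_uniq.
have s0 : s != [::] by rewrite -size_eq0 ss -lt0n -ltnS (ltn_predK k3) ltnW.
have -> : k = size (u :: s) by rewrite /= ss (ltn_predK k3).
apply: graph_cycle_has; apply: path_graph_cycle => //.
- by apply/negP => /sP; rewrite e_irr.
- apply: clique_sorted => // x y /sP/andP[ux /eqP cx] /sP/andP[uy /eqP cy] xy.
  by rewrite tc // cx cy.
- by rewrite ss -ltnS (ltn_predK k3).
- by have /sP/andP[] : head u s \in s by case: (s) s0 => // x t _; apply: mem_head.
- by have /sP/andP[] : last u s \in s
    by case: (s) s0 => // x t _; exact: (mem_last x t).
Qed.

Lemma reaching_covers : (forall x, e u x -> reaching x) -> 1 < D ->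
  covers 3 D.+1.
Proof.
move=> rc /card_gt1P[x [v [ux uv xv]]] k; rewrite !inE in ux uv.
have rx := rc x ux.
have [z uz xz] : exists2 z, e u z & e x z.
  case: rx => [h | [z [_ [uz _ xz _ _]]]]; last by exists z.
  by exists v; rewrite // h // eq_sym.
(* Length 3 is the triangle [u], [x], [z]. The seed [[:: x]] gives a dominating ring of at most
   three vertices besides [u], hence the lengths from 4 on. *)
rewrite leq_eqVlt andb_orl => /orP[/andP[/eqP <- _] | /andP[k4 kD]].
  apply: (@graph_cycle_has [:: u; x; z]); apply: path_graph_cycle => //=.
  - by rewrite inE andbT; apply: contraTneq xz => ->; rewrite e_irr.
  - rewrite !inE negb_or; apply/andP; split.
      by apply: contraTneq ux => ->; rewrite e_irr.
    by apply: contraTneq uz => ->; rewrite e_irr.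
  - by rewrite xz.
have [||bs [rb db fb nb]] := @reaching_seed [:: x] rx [::].
- by move=> g; rewrite inE => /eqP ->; apply: ear1.
- by [].
have fx : far (flatten [:: [:: x]]) = 0 by rewrite far_nbrs //= ux.
have nx : nbr (flatten [:: [:: x]]) = 1 by rewrite /nbr /= ux.
apply: (ring_has_cycle rb db); first exact: ltnW.
by rewrite -nbr_far fb fx add0n addn0 kD andbT; apply: leq_ltn_trans nb _; rewrite nx.
Qed.

(** * The Hamiltonian path [c] left after deleting [u] *)

Section HamiltonianPath.

Variable c : seq T.
Hypotheses (c_sorted : sorted e c) (c_uniq : uniq c) (c_u : u \notin c).
Hypotheses (c_head : e u (head u c)) (c_last : e u (last u c)).
Hypothesis c_full : forall x, x != u -> x \in c.

Lemma size_full : #|T| = (size c).+1.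
Proof.
rewrite -[(size c).+1]/(size (u :: c)); apply/esym/eqP; rewrite cardE.
apply/eqP/perm_size/uniq_perm; first by rewrite /= c_u.
  exact: enum_uniq.
move=> x; rewrite mem_enum inE [RHS]inE; case: eqVneq => // /c_full -> //.
Qed.

Lemma mem_full x : e u x -> x \in c.
Proof. by move=> ux; apply: c_full; apply: contraTneq ux => ->; rewrite e_irr. Qed.

(** The ears contain all non-neighbours of [u], so the last interval of their chain ends at the
    order of the graph. *)
Lemma card_full qs : uniq (flatten qs) -> {subset flatten qs <= c} ->
  (forall x, x \in c -> ~~ e u x -> x \in flatten qs) ->
  #|T| = far (flatten qs) + D.+1.
Proof.
move=> uq sq fq; rewrite size_full -(nbr_far c).
have -> : nbr c = D.
  rewrite -(nbr_degree c_uniq) size_filter [count _ _](_ : _ = 0) ?addn0 //.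
  apply/eqP; rewrite -leqn0 leqNgt -has_count; apply/hasPn => x _.
  by rewrite negb_and negbK; case ux: (e u x); rewrite //= mem_full.
have -> : far c = far (flatten qs); last by rewrite addnC addnS.
rewrite /far -!size_filter; apply/perm_size/uniq_perm; try exact: filter_uniq.
move=> x; rewrite !mem_filter /=; case ux: (e u x) => //=.
by apply/idP/idP => [xc | /sq //]; apply: fq; rewrite // ux.
Qed.

Lemma covers_full : covers 3 #|T| -> #|T| - 2 <= #|cycle_spectrum e|.
Proof.
move=> cT; rewrite -(size_iota 3 (#|T| - 2)); apply: leq_card_spectrum.
  exact: iota_uniq.
move=> k; rewrite mem_iota => hk; apply: cT; move: hk; move: #|T|; clear; lia.
Qed.

Lemma spectrum_reaching : (forall x, e u x -> reaching x) -> 1 < D ->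
  #|T| - 2 <= #|cycle_spectrum e| \/ B <= #|cycle_spectrum e|.
Proof.
move=> rc D1; have cD := reaching_covers rc D1.
have [qs [lq uq sq fq _]] :=
  long_ear_decomposition c_sorted c_uniq c_u c_head c_last.
have cT := card_full uq sq fq.
suff [cov |] : covers 3 (far (flatten qs) + D.+1) \/ B <= #|cycle_spectrum e|.
- by left; apply: covers_full; rewrite cT.
- by right.
case: qs => [|q gs] in lq uq {sq fq cT} *; first by left.
have lqq : long_ear q by apply: lq; rewrite mem_head.
have sdq : seed q by apply/reaching_seed/rc; case: lqq => -[].
have [_ nq _] := lqq.
have uqq : uniq q by move: uq; rewrite /= cat_uniq => /and3P[].
have lq1 g : g \in [:: q] -> long_ear g by rewrite inE => /eqP ->.
have uq1 : uniq (flatten [:: q]) by rewrite /= cats0.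
have c1 := seed_covers sdq lq1 uq1; rewrite /= cats0 in c1.
(* The start, with no ear in use, is the case [i = r = 0]. *)
have [cq | ?] := chain_step (leqnn 0) D1 cD c1; last by right.
exact: chain.
Qed.

(* When no long ear is bicoloured, the second clique is met by the Hamiltonian
   path only between two vertices outside the neighbourhood: cut a long ear at
   such a vertex and leave it towards the second clique. *)
Lemma bicoloured_long_ear col qs : two_cliques col ->
  (exists x y, [/\ e u x, e u y & col x != col y]) ->
  (forall q, q \in qs -> long_ear q) -> uniq (flatten qs) ->
  (forall x, x \in c -> ~~ e u x -> x \in flatten qs) ->
  (exists2 q, q \in qs & col (head u q) != col (last u q)) \/
  (forall y, y \in flatten qs -> e u y -> col y = col (head u c)) ->
  exists q0 q1, [/\ q0 \in qs, long_ear q1, col (head u q1) != col (last u q1) &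
    uniq (flatten (q1 :: rem q0 qs))].
Proof.
move=> tc [x [y [ux uy cxy]]] lq uq fq [[q qqs cq] | mono].
  exists q, q; split=> //; first exact: lq.
  by rewrite -(perm_uniq (perm_flatten (perm_to_rem qqs))).
(* [P] marks the clique not containing the head of [c]; [v] will be its first vertex on [c]. *)
pose P v := e u v && (col v != col (head u c)).
have hP : has P c.
  apply/hasP; have [cx | cx] := eqVneq (col x) (col (head u c)).
    by exists y; rewrite ?mem_full // /P uy -cx eq_sym.
  by exists x; rewrite ?mem_full // /P ux cx.
have [s1 [v [s2 [def_c Pv nP]]]] : exists s1 v s2,
    [/\ c = rcons s1 v ++ s2, P v & ~~ has P s1].
  by case: (split_find hP) => v s1 s2; exists s1, v, s2.
have /andP[uv cv] := Pv.
case/lastP: s1 => [|s1 p] in def_c nP *.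
  by rewrite def_c /= eqxx in cv.
have pv : e p v.
  move: c_sorted; rewrite def_c => /cat_sorted2[/= + _].
  by rewrite -!cats1 -catA => /cat_sorted2[_] /= /andP[].
have pc : p \in c by rewrite def_c mem_cat mem_rcons inE mem_rcons mem_head orbT.
have np : ~~ P p by move/hasPn: nP; apply; rewrite mem_rcons mem_head.
(* If [p] were in [N(u)], its neighbour [v] would have the same colour, and [p] would come before
   [v] in the marked clique. *)
have up : ~~ e u p.
  apply: contra np => up; rewrite /P up /=; apply: contra cv => /eqP <-.
  by rewrite eq_sym -tc //; apply: contraTneq pv => ->; rewrite e_irr.
have [q qqs pq] := flattenP (fq p pc up).
have lqq := lq q qqs; have [eq _ _] := lqq.
have [sq uh ul nuq endq] := eq.
have subq x' : x' \in q -> x' \in flatten qs by move=> x'q; apply/flattenP; exists q.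
have uqq : uniq q.
  move: uq; rewrite (perm_uniq (perm_flatten (perm_to_rem qqs))) /= cat_uniq.
  by case/and3P.
have ca : col (head u q) = col (head u c).
  by apply: mono => //; apply/subq/mem_head_ear.
(* All vertices of [N(u)] on the ears have the colour of the head of [c]. *)
have vqs : v \notin flatten qs.
  by apply: contra cv => vqs; rewrite (mono v vqs uv).
case/splitPr def_q: _ / pq => [s t].
case: s => [|a s] in def_q.
  by move: uh up; rewrite def_q /= => ->.
pose q1 := a :: rcons (rcons s p) v.
have sub1 : {subset q1 <= v :: q}.
  move=> x'; rewrite def_q !inE !mem_rcons !inE mem_cat inE mem_rcons inE.
  by do !case: (_ == _) => //=; case: (x' \in s); rewrite ?orbT.
have lq1 : long_ear q1.
  apply: long_ear_intro.
  - move: sq; rewrite def_q -cat_rcons -rcons_cons => /cat_sorted2[].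
    by rewrite /= => sq _; rewrite rcons_path sq last_rcons.
  - apply: contra nuq => /sub1; rewrite inE => /predU1P[uv' | //].
    by rewrite -uv' e_irr in uv.
  - by move: uh; rewrite def_q.
  - exact: uv.
  - apply/hasPn => y'; rewrite mem_rcons inE => /predU1P[-> // | y's].
    have y'q : y' \in q by rewrite def_q inE mem_cat y's orbT.
    apply/negP => uy'; move: uqq; rewrite def_q cat_uniq.
    case/and3P=> /andP[nas _] /hasPn nst _.
    have lt : last u q \in p :: t by rewrite def_q last_cat; exact: (mem_last p t).
    case: (endq y' y'q uy') => y'E; first by rewrite y'E def_q /= (negPf nas) in y's.
    by have := nst _ lt; rewrite -y'E /= inE y's orbT.
  - by rewrite -size_eq0 size_rcons.
exists q, q1; split=> //.
- by rewrite /= last_rcons; move: ca; rewrite def_q /= => ->; rewrite eq_sym.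
have [vq1 uq1] : v \notin a :: rcons s p /\ uniq (a :: rcons s p).
  split.
    apply: contra vqs => vq; apply: subq; rewrite def_q -cat_rcons.
    by rewrite mem_cat vq.
  by move: uqq; rewrite def_q -cat_rcons cat_uniq => /and3P[].
have /and3P[_ /hasPn nq ur] : [&& uniq q, ~~ has (mem q) (flatten (rem q qs)) &
    uniq (flatten (rem q qs))].
  rewrite -cat_uniq -[_ ++ _]/(flatten (q :: _)).
  by rewrite -(perm_uniq (perm_flatten (perm_to_rem qqs))).
change (uniq (q1 ++ flatten (rem q qs))); rewrite cat_uniq ur andbT.
apply/andP; split; first by rewrite /q1 -rcons_cons rcons_uniq vq1.
apply/hasPn => y' y'r; apply/negP => /sub1; rewrite inE => /predU1P[y'v | y'q].
  case/negP: vqs; rewrite -y'v.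
  have [g /mem_rem gqs y'g] := flattenP y'r.
  by apply/flattenP; exists g.
by have := nq _ y'r; rewrite /= y'q.
Qed.

Lemma spectrum_two_cliques col : two_cliques col ->
  (exists x y, [/\ e u x, e u y & col x != col y]) -> 1 < D ->
  #|T| - 2 <= #|cycle_spectrum e| \/ B <= #|cycle_spectrum e|.
Proof.
move=> tc bic D1; have [qs [lq uq sq fq cq]] :=
  long_ear_decomposition c_sorted c_uniq c_u c_head c_last.
have cT := card_full uq sq fq; have [mono shr] := cq col tc.
have [q0 [q1 [q0qs lq1 bq1 uq1]]] := bicoloured_long_ear tc bic lq uq fq mono.
have [a aD ca] := two_cliques_covers tc.
have [eq1 nq1 fq1] := lq1; have dq1 := bicoloured_dominating tc eq1 bq1.
have uqq1 : uniq q1 by move: uq1; rewrite /= cat_uniq => /and3P[].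
(* [q1] alone is a dominating ring with two vertices in [N(u)]. *)
have c1 : covers (far q1).+3 (far q1 + D.+1).
  move=> k /andP[k1 k2].
  apply: (@ring_has_cycle [:: q1]); rewrite /= ?cats0 //; first exact: ring1.
    exact: leq_trans k1.
  by rewrite -nbr_far nq1 k1.
(* A gap here leaves [a - 1] lengths below it and [D - 1] above. *)
have [cov1 | ?] := covers_join ca c1; last first.
  right; apply: leq_trans (_ : _ <= _) _; last eassumption.
  by move: D aD D1 (far _); clear; lia.
have lg g : g \in q1 :: rem q0 qs -> long_ear g.
  by rewrite inE => /predU1P[-> // | /mem_rem/lq].
have [cov2 | ?] := chain (dominating_seed dq1) lg uq1 cov1; last by right.
have [nqs _] := long_ears_count lq.
(* Replacing [q0] by [q1] keeps the number of long ears. *)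
have kr : size qs <= far (flatten (q1 :: rem q0 qs)).
  have [_] := long_ears_count lg; rewrite [size _]/= size_rem // prednK //.
  by rewrite lt0n size_eq0; case: (qs) q0qs.
have kD := nbr_leq_degree uq; rewrite nqs in kD.
(* [q1] may miss vertices of [q0], so the chain may stop short of [#|T|]. Shortening the Hamiltonian
   path supplies the top interval. *)
have F : covers (size (flatten qs)).+1 #|T|.
  move=> k /andP[k1 k2]; have k0 : k.-1.+1 = k by exact: ltn_predK k1.
  have [|s [ss us sub ps es]] := shr k.-1.
    by rewrite -ltnS k0 k1 -ltnS k0 -size_full.
  have s2 : 1 < size s.
    rewrite ss -ltnS k0; apply: leq_ltn_trans k1; rewrite -nbr_far nqs.
    by case: (qs) q0qs => // g gs _; rewrite mulnS -addnA leq_addr.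
  have -> : k = size (u :: s) by rewrite /= ss k0.
  apply: graph_cycle_has; apply: path_graph_cycle => //.
  - by apply: contra c_u => /sub.
  - by case: es s2 => [-> | []].
  - by case: es s2 => [-> | []].
(* A gap gives at least [2 * D - size qs] lengths, and [size qs] is at most half of [D]. *)
have [cov3 | h3] := covers_join cov2 F; first by left; apply: covers_full.
right; apply: leq_trans h3; rewrite -nbr_far nqs cT.
move: kr kD; move: (far (flatten (_ :: _))) (far (flatten qs)) (size qs) D.
by clear; lia.
Qed.


Lemma spectrum_bound : 1 < D ->
  #|T| - 2 <= #|cycle_spectrum e| \/ B <= #|cycle_spectrum e|.
Proof.
move=> D1; case: reaching_or_two_cliques => [rc | [col [x [y [tc ux uy cxy]]]]].
  exact: spectrum_reaching.
by apply: spectrum_two_cliques tc _ D1; exists x, y.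
Qed.

End HamiltonianPath.

End Neighbourhood.

(** * The bound at a vertex of maximum degree *)

Lemma claw_free_edge (T : finType) (e : rel T) : symmetric e -> irreflexive e ->
  claw_free e -> forall c x y z, e c x -> e c y -> e c z ->
  x != y -> x != z -> y != z -> [|| e x y, e x z | e y z].
Proof.
move=> e_sym e_irr cf c x y z cx cy cz xy xz yz.
apply/negP => /negP; rewrite !negb_or => /and3P[nxy nxz nyz]; apply: cf.
have ne v : e c v -> c != v by apply: contraTneq => <-; rewrite e_irr.
exists (fun i : 'I_4 => nth c [:: c; x; y; z] i).
  move=> i j /eqP; rewrite nth_uniq ?ltn_ord //; first by move/eqP/val_inj.
  by rewrite /= !inE !negb_or !ne // xy xz yz.
move=> [[|[|[|[|i]]]] //= ?] [[|[|[|[|j]]]] //= ?];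
  by rewrite /K1_3 -!val_eqE /= ?e_irr // ?(e_sym _ c) ?cx ?cy ?cz //
    ?(negPf nxy) ?(negPf nxz) ?(negPf nyz) // e_sym
    ?(negPf nxy) ?(negPf nxz) ?(negPf nyz).
Qed.

Theorem theorem1 (T : finType) (e : rel T)
  (e_sym : symmetric e) (e_irr : irreflexive e)
  (e_claw_free : claw_free e) (e_ham : hamiltonian e)
  (Delta_ge24 : 24 <= max_degree e) :
  minn #|T| (uphalf (3 * max_degree e)) - 2 <= #|cycle_spectrum e|.
Proof.
have [c0 c0cyc c0full] := e_ham.
have [u Du] : {u | max_degree e = degree e u}.
  apply: eq_bigmax; case: c0 c0cyc {c0full} => // x c0 _.
  by apply/card_gt0P; exists x.
(* Rotated to start at [u], the Hamiltonian cycle leaves a path [c] through all other vertices, with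
   both ends in [N(u)]. *)
have [i c rot_c] := rot_to (c0full u).
have /andP[] : ucycleb e (u :: c).
  by rewrite -rot_c /ucycleb rot_cycle rot_uniq; case/andP: c0cyc.
rewrite /= rcons_path => /andP[pc lc] /andP[nuc uc].
have sc : size c0 = (size c).+1 by have := congr1 size rot_c; rewrite size_rot.
have cfull x : x != u -> x \in c.
  move=> xu; have : x \in rot i c0 by rewrite mem_rot c0full.
  by rewrite rot_c inE (negPf xu).
case: c => [|y c] in rot_c pc lc nuc uc sc cfull.
  by move: c0cyc; rewrite /graph_cycle sc.
case/andP: pc => uy pc.
have D1 : 1 < degree e u by rewrite -Du (leq_trans _ Delta_ge24).
rewrite Du; have [h | h] := spectrum_bound e_sym e_irr
  (claw_free_edge e_sym e_irr e_claw_free) (c := y :: c) pc uc nuc uy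
  (etrans (e_sym _ _) lc) cfull D1; apply: leq_trans h; apply: leq_sub2r.
  exact: geq_minl.
exact: geq_minr.
Qed.
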